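(* Let $\mathcal{W}=\sum_{i=0}^{p}(\underline{A}^{T})^{i}\underline{C}^{T}\underline{C}\,\underline{A}^{i}\in\mathbb{R}^{Nn\times Nn}$ be the finite-time observability Gramian of the global system described in the context, and assume that the $p$-steps observability matrix $O_{p}$ has full column rank $Nn$ (so that $\mathcal{W}$ is invertible). Let $a$ and $b$ be the minimal and maximal singular values of $\mathcal{W}$, respectively, and let $\kappa=b/a$ be the condition number of $\mathcal{W}$. Define the Newton-Schultz iteration by $$X_{0}=\frac{2}{a^{2}+b^{2}}\,\mathcal{W},\qquad X_{k+1}=X_{k}\left(2I-\mathcal{W}X_{k}\right),\quad k=0,1,2,\ldots,$$ and set $\mathcal{E}_{k}=I-\mathcal{W}X_{k}$. Then for every $k=0,1,2,\ldots$, $$\left\|\mathcal{E}_{k}\right\|_{2}\le\left(\frac{\kappa^{2}-1}{\kappa^{2}+1}\right)^{2^{k}}.$$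
   Context: $N,n,r$ are positive integers and $p$ is a nonnegative integer. $\underline{A}=[A_{i,j}]\in\mathbb{R}^{Nn\times Nn}$ is a real block matrix with blocks $A_{i,j}\in\mathbb{R}^{n\times n}$, $1\le i,j\le N$, and $\underline{C}=\mathrm{diag}(C_{1},\ldots,C_{N})\in\mathbb{R}^{Nr\times Nn}$ is a block diagonal real matrix with $C_{i}\in\mathbb{R}^{r\times n}$; these are the state matrix and output matrix of a discrete-time linear system $\underline{\mathbf{x}}(k+1)=\underline{A}\,\underline{\mathbf{x}}(k)+\underline{B}\,\underline{\mathbf{u}}(k)$, $\underline{\mathbf{y}}(k)=\underline{C}\,\underline{\mathbf{x}}(k)+\underline{D}\,\underline{\mathbf{u}}(k)+\underline{\mathbf{n}}(k)$ (the global system). The $p$-steps observability matrix is $O_{p}=\begin{bmatrix}\underline{C}^{T} & (\underline{C}\,\underline{A})^{T} & \cdots & (\underline{C}\,\underline{A}^{p})^{T}\end{bmatrix}^{T}$, so that $\mathcal{W}=O_{p}^{T}O_{p}$. $\|\cdot\|_{2}$ denotes the spectral norm, and $I$ the identity matrix. *)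

(* Defs.v *)
From mathcomp Require Import all_boot all_order all_algebra.
From mathcomp Require Import classical_sets reals.

Set Implicit Arguments.
Unset Strict Implicit.
Unset Printing Implicit Defensive.

Import Order.TTheory GRing.Theory Num.Theory.
Local Open Scope classical_set_scope.
Local Open Scope ring_scope.

(* The norm `|x| that MathComp-Analysis puts on matrices is the entrywise
   maximum, so the Euclidean norm is defined here. *)
Definition euclid_norm (R : realType) (n : nat) (x : 'cV[R]_n) : R :=
  Num.sqrt (\sum_(i < n) x i 0 ^+ 2).

(* Operator norm induced by the Euclidean norms. *)
Definition spectral_norm (R : realType) (m n : nat) (A : 'M[R]_(m, n)) : R :=
  sup [set euclid_norm (A *m x) | x in [set x : 'cV[R]_n | euclid_norm x <= 1]].

(* Restricted to square matrices: for a wide matrix, A^T A has extra zero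
   eigenvalues that are not counted as singular values. *)
Definition singular_value (R : realType) (n : nat) (A : 'M[R]_n) : set R :=
  [set s | 0 <= s /\ eigenvalue (A^T *m A) (s ^+ 2)].

(* For n > 0 the set of singular values is finite and nonempty, so that the
   infimum and the supremum are attained. *)
Definition min_singular_value (R : realType) (n : nat) (A : 'M[R]_n) : R :=
  inf (singular_value A).

Definition max_singular_value (R : realType) (n : nat) (A : 'M[R]_n) : R :=
  sup (singular_value A).

(* MathComp's block matrices have sizes of the form \sum_(i < N) n, which is
   N * n only up to a provable equality (sum_nat_const and card_ord). *)
Definition global_state (R : realType) (N n : nat)
    (A : 'I_N -> 'I_N -> 'M[R]_n) : 'M[R]_(\sum_(i < N) n) :=
  \mxblock_(i < N, j < N) A i j.

(* \mxdiag requires square blocks, hence the explicit zero blocks. *)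
Definition global_output (R : realType) (N n r : nat)
    (C : 'I_N -> 'M[R]_(r, n)) : 'M[R]_(\sum_(i < N) r, \sum_(i < N) n) :=
  \mxblock_(i < N, j < N) (if i == j then C i else 0).

Definition observability_matrix (R : realType) (m q p : nat)
    (A : 'M[R]_m) (C : 'M[R]_(q, m)) : 'M[R]_(\sum_(i < p.+1) q, m) :=
  \mxcol_(i < p.+1) (C *m A ^+ i).

Definition observability_gramian (R : realType) (m q p : nat)
    (A : 'M[R]_m) (C : 'M[R]_(q, m)) : 'M[R]_m :=
  \sum_(i < p.+1) A^T ^+ i *m C^T *m C *m A ^+ i.

Fixpoint newton_schultz (R : realType) (m : nat) (W X0 : 'M[R]_m) (k : nat)
    : 'M[R]_m :=
  if k is k'.+1 then
    let X := newton_schultz W X0 k' in X *m (2%:M - W *m X)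
  else X0.

(* Main.v *)
(* The residuals satisfy E_{k+1} = E_k^2, so it suffices to bound
   E_0 = I - 2/(a^2+b^2) W^2, where W = O_p^T O_p is symmetric and invertible.
   By the spectral theorem, applied over R[i], its norm is governed by the
   numbers 1 - 2t/(a^2+b^2) with t an eigenvalue of W^2; as t lies in
   [a^2, b^2], these have modulus at most
   (b^2-a^2)/(a^2+b^2) = (kappa^2-1)/(kappa^2+1). *)

From mathcomp Require Import all_boot all_order all_algebra.
From mathcomp Require Import spectral complex ring lra.
Require Import Defs.
From mathcomp Require Import classical_sets reals.

Set Implicit Arguments.
Unset Strict Implicit.
Unset Printing Implicit Defensive.

Import Order.TTheory GRing.Theory Num.Theory.
Local Open Scope ring_scope.

Lemma sum_normr_sqr_invmx_unitary (C : numClosedFieldType) m (P : 'M[C]_m)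
    (u : 'cV[C]_m) : P \is unitarymx ->
  \sum_i `|(invmx P *m u) i 0| ^+ 2 = \sum_i `|u i 0| ^+ 2.
Proof.
have dotE (v : 'cV[C]_m) :
    \sum_i `|v i 0| ^+ 2 = (map_mx Num.conj v^T *m v) 0 0.
  by rewrite mxE; apply: eq_bigr => i _; rewrite !mxE normCK mulrC.
move=> Pu; rewrite !dotE invmx_unitary //.
rewrite trmx_mul map_mxM trmxCK mulmxA -(mulmxA (map_mx _ _)).
by rewrite (unitarymxP Pu) mulmx1.
Qed.

(* [w] lists the squared coordinates of [x] in an orthonormal eigenbasis, so
   that the norms of all the [(c + s S) x] are read off simultaneously. *)
Lemma symmetric_spectral_weights (R : rcfType) m (S : 'M[R]_m) : S^T = S ->
  exists2 d : 'I_m -> R, forall i, eigenvalue S (d i) &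
    forall x : 'cV[R]_m, exists2 w : 'I_m -> R, forall i, 0 <= w i &
      forall c s, \sum_i ((c%:M + s *: S) *m x) i 0 ^+ 2 =
                  \sum_i (c + s * d i) ^+ 2 * w i.
Proof.
move=> Ssym; pose f : {rmorphism R -> complex R} := real_complex R; pose M := map_mx f S.
have f_real a : f a \is Num.real by apply/complex_realP; exists a.
have Mherm : M \is hermsymmx.
  apply: realsym_hermsym; last by apply/mxOverP => i j; rewrite mxE.
  apply/is_hermitianmxP; rewrite expr0 scale1r map_mx_id //.
  by rewrite /M map_trmx Ssym.
have Dreal := hermitian_spectral_diag_real Mherm.
have /orthomx_spectralP := hermitian_normalmx Mherm.
have := spectral_unitarymx M.
move: (spectralmx M) (spectral_diag M) Dreal => P D Dreal Pu ME.
have Punit := unitarymx_unit Pu.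
pose d i := complex.Re (D 0 i).
have dE i : f (d i) = D 0 i by apply: RRe_real; exact: (mxOverP Dreal).
exists d => [i|x].
  (* Since [M] is [invmx P *m diag_mx D *m P], each row of [P] is a left eigenvector of [M]; the
     eigenvalue, being real, descends to [S]. *)
  suff: eigenvalue M (D 0 i) by rewrite -dE eigenvalue_map.
  apply/eigenvalueP; exists (row i P).
    rewrite -row_mul ME !mulmxA mulmxV // mul1mx row_mul row_diag_mx.
    by rewrite -scalemxAl -rowE.
  apply: contraTneq isT => row0.
  have : row i P *m invmx P = delta_mx 0 i by rewrite -row_mul mulmxV // row1.
  rewrite row0 mul0mx => /rowP/(_ i)/eqP.
  by rewrite !mxE !eqxx eq_sym oner_eq0.
pose y := P *m map_mx f x.
(* The weights are the squared moduli of the coordinates [y] of [x] in the eigenbasis. They are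
   real, so taking the real part loses nothing. *)
exists (fun i => complex.Re (`|y i 0| ^+ 2)) => [i|c s].
  by rewrite -ler0c RRe_real ?exprn_ge0 // rpredX // normr_real.
apply: (fmorph_inj f); rewrite !rmorph_sum.
(* One unitary [P] diagonalizes every c + s S; its inverse then drops out of the sum of squared
   moduli. *)
have yE : map_mx f ((c%:M + s *: S) *m x) =
    invmx P *m (diag_mx (\row_i (f c + f s * D 0 i)) *m y).
  have -> : diag_mx (\row_i (f c + f s * D 0 i)) = (f c)%:M + f s *: diag_mx D.
    by apply/matrixP => i j; rewrite !mxE; case: eqP; rewrite ?mulr1n // !mulr0n mulr0 addr0.
  rewrite map_mxM map_mxD map_scalar_mx map_mxZ -/M ME /y !mulmxA.
  congr (_ *m _); rewrite mulmxDr mulmxDl mul_mx_scalar -scalemxAl mulVmx //.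
  by rewrite scalemx1 -scalemxAr -scalemxAl.
transitivity (\sum_i `|(map_mx f ((c%:M + s *: S) *m x)) i 0| ^+ 2).
  by apply: eq_bigr => i _; rewrite [in RHS]mxE real_normK // rmorphXn.
rewrite yE sum_normr_sqr_invmx_unitary //; apply: eq_bigr => i _.
rewrite mul_diag_mx mxE mxE normrM exprMn rmorphM rmorphXn rmorphD rmorphM.
rewrite dE real_normK ?rpredD ?rpredM ?f_real //; last by rewrite -dE f_real.
by congr (_ * _); apply/esym/RRe_real; rewrite rpredX // normr_real.
Qed.

Lemma sum_sqr_gt0 (R : realDomainType) m (x : 'cV[R]_m) :
  x != 0 -> 0 < \sum_i x i 0 ^+ 2.
Proof.
move=> x0; rewrite lt_def sumr_ge0 => [|i _]; last exact: sqr_ge0.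
rewrite andbT; apply: contra x0 => /eqP s0; apply/eqP/colP => i.
have /eqP := @psumr_eq0P _ _ _ _ (fun j _ => sqr_ge0 (x j 0)) s0 i isT.
by rewrite sqrf_eq0 mxE => /eqP.
Qed.

Lemma sum_sqr_mulmx (R : comPzRingType) m (x : 'cV[R]_m) :
  \sum_i x i 0 ^+ 2 = (x^T *m x) 0 0.
Proof. by rewrite mxE; apply: eq_bigr => i _; rewrite mxE expr2. Qed.

(** For a row eigenvector v, the squared length of W v^T is v W^T W v^T = t |v|^2, and both squared
    lengths are positive. *)
Lemma gram_eigenvalue_gt0 (R : realFieldType) m (W : 'M[R]_m) t :
  W \in unitmx -> eigenvalue (W^T *m W) t -> 0 < t.
Proof.
move=> Wu /eigenvalueP[v vS v0].
have vT0 : v^T != 0 by rewrite trmx_eq0.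
have Wv0 : W *m v^T != 0.
  by apply: contra vT0 => /eqP Wv; rewrite -(mulKmx Wu v^T) Wv mulmx0.
have : \sum_i (W *m v^T) i 0 ^+ 2 = t * \sum_i v^T i 0 ^+ 2.
  rewrite !sum_sqr_mulmx trmx_mul trmxK -mulmxA (mulmxA W^T) mulmxA vS.
  by rewrite -scalemxAl mxE.
move=> E; have := sum_sqr_gt0 Wv0.
by rewrite E (pmulr_lgt0 _ (sum_sqr_gt0 vT0)).
Qed.

(** The d i exhaust the spectrum of W^T W, so the singular values are exactly the square roots of
    the d i: a finite nonempty family, on which the infimum and the supremum behave as minimum and
    maximum. *)
Lemma singular_value_bounds (R : realType) m (W : 'M[R]_m) : (0 < m)%N ->
  W \in unitmx ->
  0 < min_singular_value W /\
  forall t, eigenvalue (W^T *m W) t ->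
    min_singular_value W ^+ 2 <= t <= max_singular_value W ^+ 2.
Proof.
move=> m0 Wu; set S := W^T *m W.
have Ssym : S^T = S by rewrite trmx_mul trmxK.
have [d dev dw] := symmetric_spectral_weights Ssym.
(* For an eigenvector of t, the choice c = -t, s = 1 makes the sum of (d i - t)^2 w i vanish, while
   c = 1, s = 0 shows that the weights have a positive sum. Some w i is then nonzero, which forces t
   = d i. *)
have evd t : eigenvalue S t -> exists i, t = d i.
  move=> /eigenvalueP[v vS v0].
  have vT0 : v^T != 0 by rewrite trmx_eq0.
  have [w w0 wE] := dw v^T.
  have St : ((- t)%:M + 1 *: S) *m v^T = 0.
    rewrite scale1r -Ssym -[LHS]trmxK trmx_mul trmxK linearD /= trmxK tr_scalar_mx.
    by rewrite mulmxDr vS mul_mx_scalar scaleNr addNr trmx0.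
  have := wE (- t) 1; rewrite St big1 => [/esym s0|i _]; last by rewrite mxE expr0n.
  have /sum_sqr_gt0 := vT0; have := wE 1 0.
  rewrite scale0r addr0 mul1mx => ->.
  under eq_bigr do rewrite mul0r addr0 expr1n mul1r.
  rewrite lt_def => /andP[/eqP sw _].
  have /existsP[i wi] : [exists i, w i != 0].
    apply: contra_notT sw; rewrite negb_exists => /forallP w00.
    by rewrite big1 // => i _; apply/eqP; have := w00 i; rewrite negbK.
  exists i.
  have /eqP := @psumr_eq0P _ _ _ _
      (fun j _ => mulr_ge0 (sqr_ge0 (- t + 1 * d j)) (w0 j)) s0 i isT.
  rewrite mulf_eq0 (negPf wi) orbF sqrf_eq0 mul1r addrC subr_eq0.
  by move=> /eqP.
have dgt0 i : 0 < d i by apply: gram_eigenvalue_gt0 Wu (dev i).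
have svd i : singular_value W (Num.sqrt (d i)).
  by split; rewrite ?sqrtr_ge0 // sqr_sqrtr ?dev // ltW.
pose i0 := Ordinal m0.
have ne : (singular_value W !=set0)%classic by exists (Num.sqrt (d i0)).
have svE s : singular_value W s -> exists i, s = Num.sqrt (d i).
  move=> [s0 /evd[i si]]; exists i.
  by rewrite -si sqrtr_sqr ger0_norm.
have hlb : has_lbound (singular_value W) by exists 0 => s [].
have hub : has_ubound (singular_value W).
  exists (\sum_i Num.sqrt (d i)) => s /svE[i ->].
  by rewrite (bigD1 i) //= lerDl sumr_ge0 // => j _; exact: sqrtr_ge0.
have a0 : 0 < min_singular_value W.
  (* Positive elements alone could have infimum 0; the least d i supplies a positive lower bound. *)
  case: (arg_minP (P := predT) (i0 := i0) d isT) => i _ imin.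
  apply: (@lt_le_trans _ _ (Num.sqrt (d i))); first by rewrite sqrtr_gt0.
  apply: lb_le_inf => // s /svE[j ->]; by rewrite ler_wsqrtr // imin.
split=> // t /evd[i ->]; rewrite -(sqr_sqrtr (ltW (dgt0 i))).
have ai : min_singular_value W <= Num.sqrt (d i) by apply: ge_inf.
have bi : Num.sqrt (d i) <= max_singular_value W by apply: ub_le_sup.
by rewrite !ler_sqr ?nnegrE ?sqrtr_ge0 ?ai ?bi // ?(ltW a0) // (le_trans _ bi) ?sqrtr_ge0.
Qed.

(** With Y = W X_k this is 1 - Y (2 - Y) = (1 - Y)^2, an identity in powers of the single matrix
    Y. *)
Lemma newton_schultz_residual (R : realType) m (W X0 : 'M[R]_m) k :
  let E j := 1%:M - W *m newton_schultz W X0 j in E k.+1 = E k *m E k.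
Proof.
move=> /=; set X := newton_schultz W X0 k; set Y := W *m X.
have -> : (2%:M : 'M[R]_m) = 1%:M + 1%:M by rewrite -raddfD.
rewrite mulmxA -/Y !mulmxBr mulmxDr !mulmxBl !mulmx1 mul1mx.
by apply/matrixP => i j; rewrite !mxE; ring.
Qed.

Lemma spectral_norm_le (R : realType) m n (A : 'M[R]_(m, n)) c : 0 <= c ->
  (forall x, euclid_norm (A *m x) <= c * euclid_norm x) -> spectral_norm A <= c.
Proof.
move=> c0 Ac; apply: ge_sup => [|_ [x /= x1 <-]].
  exists (euclid_norm (A *m 0)), 0 => //=.
  rewrite /euclid_norm big1 ?sqrtr0 // => i _; by rewrite mxE expr0n.
by rewrite (le_trans (Ac x)) // ler_piMr.
Qed.

Lemma observability_gramianE (R : realType) m q p (A : 'M[R]_m)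
    (C : 'M[R]_(q, m)) :
  observability_gramian p A C =
  (observability_matrix p A C)^T *m observability_matrix p A C.
Proof.
rewrite /observability_matrix tr_mxcol mul_mxrow_mxcol.
apply: eq_bigr => i _; rewrite trmx_mul mulmxA; congr (_ *m _ *m _ *m _).
by elim: (i : nat) => [|j IH]; rewrite ?expr0 ?trmx1 // exprS exprSr trmx_mul IH.
Qed.

(** If v A^T A = 0, then |A v^T|^2 = v A^T A v^T = 0, so v A^T = 0, and full column rank of A gives
    v = 0. *)
Lemma gram_unitmx (R : realFieldType) m n (A : 'M[R]_(m, n)) :
  \rank A = n -> A^T *m A \in unitmx.
Proof.
move=> rA; rewrite -row_free_unit -kermx_eq0; apply/rowV0P => v /sub_kermxP vA.
have Av0 : A *m v^T = 0.
  apply: contraTeq isT => /sum_sqr_gt0.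
  by rewrite sum_sqr_mulmx trmx_mul trmxK mulmxA -(mulmxA v) vA mul0mx mxE ltxx.
have ATfree : row_free A^T by rewrite /row_free mxrank_tr rA.
apply: (row_free_inj ATfree); rewrite mul0mx.
by rewrite -[v]trmxK -trmx_mul Av0 trmx0.
Qed.

Lemma newton_schultz_residual0_le (R : realType) m (W : 'M[R]_m) :
  (0 < m)%N -> W^T = W -> W \in unitmx ->
  let a := min_singular_value W in
  let b := max_singular_value W in
  let rho := (b ^+ 2 - a ^+ 2) / (a ^+ 2 + b ^+ 2) in
  0 <= rho /\
  forall x : 'cV[R]_m,
    euclid_norm ((1%:M - W *m ((2 / (a ^+ 2 + b ^+ 2)) *: W)) *m x)
      <= rho * euclid_norm x.
Proof.
move=> m0 Wsym Wu a b; have [a0 ab] := singular_value_bounds m0 Wu.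
move: a0 ab; rewrite -/a -/b Wsym => a0 ab.
have Ssym : (W *m W)^T = W *m W by rewrite trmx_mul Wsym.
have [d dev dw] := symmetric_spectral_weights Ssym.
have s0 : 0 < a ^+ 2 + b ^+ 2 by rewrite ltr_pwDl ?exprn_gt0 // sqr_ge0.
move=> rho; have rho0 : 0 <= rho.
  (* Any eigenvalue, lying between a^2 and b^2, witnesses a^2 <= b^2. *)
  have /andP[h1 h2] := ab _ (dev (Ordinal m0)).
  by rewrite divr_ge0 ?subr_ge0 ?(le_trans h1 h2) // ltW.
split=> // x; have [w w0 wE] := dw x.
(* The scale is the reciprocal of the midpoint of [a^2, b^2], so 1 - c t takes the opposite values
   rho and -rho at the endpoints. *)
set c := 2 / _.
have -> : 1%:M - W *m (c *: W) = 1%:M + (- c) *: (W *m W).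
  by rewrite -scalemxAr scaleNr.
rewrite /euclid_norm wE -{1}(mul1mx x).
have := wE 1 0; rewrite scale0r addr0 => ->.
rewrite -{1}(ger0_norm rho0) -sqrtr_sqr -sqrtrM ?sqr_ge0 // ler_wsqrtr //.
(* Both norms are now sums over the same weights, so comparing the factors termwise suffices. *)
rewrite mulr_sumr; apply: ler_sum => i _.
rewrite mul0r addr0 expr1n mul1r ler_wpM2r // ?w0 //.
rewrite -[leLHS]real_normK ?num_real // ler_sqr ?nnegrE //.
have -> : 1 + - c * d i = (a ^+ 2 + b ^+ 2 - 2 * d i) / (a ^+ 2 + b ^+ 2).
  by rewrite /c; field; rewrite gt_eqF.
rewrite normrM [X in _ * X]gtr0_norm ?invr_gt0 //.
rewrite ler_wpM2r ?invr_ge0 ?(ltW s0) // ler_norml.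
have /andP[] := ab _ (dev i); lra.
Qed.

(** The bound is kept vectorwise so that the squaring step just applies the induction hypothesis
    twice, first at E_k x and then at x; this doubles the exponent. *)
Lemma newton_schultz_residual_le (R : realType) m (W X0 : 'M[R]_m) rho :
  0 <= rho ->
  (forall x : 'cV[R]_m,
    euclid_norm ((1%:M - W *m X0) *m x) <= rho * euclid_norm x) ->
  forall k (x : 'cV[R]_m),
    euclid_norm ((1%:M - W *m newton_schultz W X0 k) *m x)
      <= rho ^+ (2 ^ k) * euclid_norm x.
Proof.
move=> rho0 E0; elim=> [|k IH] x; first by rewrite expr1; exact: E0.
rewrite newton_schultz_residual -mulmxA (le_trans (IH _)) //.
rewrite expnS mul2n -addnn exprD -mulrA.
by rewrite ler_wpM2l ?exprn_ge0 // IH.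
Qed.

Theorem mainTheorem1 (R : realType) (N n r p : nat)
    (hN : (0 < N)%N) (hn : (0 < n)%N) (hr : (0 < r)%N)
    (A : 'I_N -> 'I_N -> 'M[R]_n) (C : 'I_N -> 'M[R]_(r, n)) :
  let A_ := global_state A in
  let C_ := global_output C in
  let W := observability_gramian p A_ C_ in
  \rank (observability_matrix p A_ C_) = (N * n)%N ->
  let a := min_singular_value W in
  let b := max_singular_value W in
  let kappa := b / a in
  let X := newton_schultz W ((2 / (a ^+ 2 + b ^+ 2)) *: W) in
  let E k := 1%:M - W *m X k in
  forall k : nat,
    spectral_norm (E k)
      <= ((kappa ^+ 2 - 1) / (kappa ^+ 2 + 1)) ^+ (2 ^ k).
Proof.
move=> A_ C_ W Orank a b kappa X E k.
have WE : W = _ := observability_gramianE p A_ C_.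
have sumn : (\sum_(i < N) n = N * n)%N by rewrite sum_nat_const card_ord.
have m0 : (0 < \sum_(i < N) n)%N by rewrite sumn muln_gt0 hN.
have Wu : W \in unitmx by rewrite WE gram_unitmx // Orank sumn.
have Wsym : W^T = W by rewrite WE trmx_mul trmxK.
have [rho0 E0] := newton_schultz_residual0_le m0 Wsym Wu.
have [a0 _] := singular_value_bounds m0 Wu.
(* Numerator and denominator are multiplied by a^2, which is nonzero because W is invertible. *)
have -> : (kappa ^+ 2 - 1) / (kappa ^+ 2 + 1) =
    (b ^+ 2 - a ^+ 2) / (a ^+ 2 + b ^+ 2).
  have a2 : 0 < a ^+ 2 by rewrite exprn_gt0.
  rewrite /kappa; field; rewrite (gt_eqF a0) /= !gt_eqF //.
  by rewrite ltr_pwDl // sqr_ge0.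
apply: spectral_norm_le; first by rewrite exprn_ge0.
exact: newton_schultz_residual_le rho0 E0 k.
Qed.
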